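(* Let $1<p<\infty$ and $0<\alpha<\infty$. Then: (1) the Cesàro operator $\mathsf{C}$ fails to be an isomorphism on $A^p_{\alpha+}$; (2) the Cesàro operator $\mathsf{C}$ fails to be an isomorphism on $A^p_{\alpha-}$.
   Context: $\mathbb{D}=\{z\in\mathbb{C}:|z|<1\}$, $H(\mathbb{D})$ is the space of all analytic functions on $\mathbb{D}$, and $\mathbb{N}=\{1,2,\dots\}$. For $1<p<\infty$ and $0<\mu<\infty$, the weighted Bergman space $A^p_\mu$ is the Banach space of all $f\in H(\mathbb{D})$ with $\|f\|_{p,\mu}:=\left(\int_{\mathbb{D}}|f(z)|^p(1-|z|)^\mu\,ds(z)\right)^{1/p}<\infty$, where $ds(z)=\frac1\pi\,dx\,dy$. For $0<\alpha<\infty$, $A^p_{\alpha+}:=\bigcap_{\mu>\alpha}A^p_\mu=\bigcap_{n\in\mathbb{N}}A^p_{\alpha+1/n}$, a Fréchet space with the topology generated by the increasing sequence of norms $\|\cdot\|_{p,\alpha+1/n}$, $n\in\mathbb{N}$ (i.e. the projective limit of the Banach spaces $A^p_{\alpha+1/n}$). For $0<\alpha<\infty$, $A^p_{\alpha-}:=\bigcup_{0<\mu<\alpha}A^p_\mu=\bigcup_{n\in\mathbb{N},\,n>1/\alpha}A^p_{\alpha-1/n}$, with the finest locally convex topology for which all inclusions $A^p_\mu\hookrightarrow A^p_{\alpha-}$, $0<\mu<\alpha$, are continuous (i.e. the (LB)-space that is the inductive limit of the Banach spaces $A^p_{\alpha-1/n}$). The Cesàro operator is $\mathsf{C}(f)(z)=\frac1z\int_0^z\frac{f(\zeta)}{1-\zeta}\,d\zeta$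 for $z\in\mathbb{D}\setminus\{0\}$, $\mathsf{C}(f)(0)=f(0)$, for $f\in H(\mathbb{D})$. It restricts to continuous linear operators on $A^p_{\alpha+}$ and on $A^p_{\alpha-}$. ''Isomorphism on $X$'' means a linear bijection of $X$ onto $X$ that is continuous with continuous inverse. *)

(* Defs.v *)
From HB Require Import structures.
From mathcomp Require Import all_boot all_order all_algebra.
From mathcomp Require Import complex lra.
From mathcomp Require Import all_classical all_reals all_analysis.
From mathcomp Require Import measurable_realfun.

Set Implicit Arguments.
Unset Strict Implicit.
Unset Printing Implicit Defensive.

Import Order.TTheory GRing.Theory Num.Theory.
Import numFieldNormedType.Exports.
Import ComplexField.Normc.

Local Open Scope classical_set_scope.
Local Open Scope complex_scope.
Local Open Scope ring_scope.

Section disc.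
Variable R : realType.
Implicit Types (f g : R[i] -> R[i]^o) (z : R[i]) (p mu : R).

Definition disc : set R[i] := [set z | normc z < 1].

(* H(D), with the holomorphic functions on D represented by their extensions by
   0 to R[i]: equality in H(D) is then equality of functions.  Derivability is
   complex derivability, R[i]^o being the one-dimensional normed R[i]-space. *)
Definition analytic_on_disc f : Prop :=
  (forall z : R[i]^o, disc z -> derivable (f : R[i]^o -> R[i]^o) z 1) /\
  (forall z, ~ disc z -> f z = 0).

Definition complex_of (w : R * R) : R[i] := w.1 +i* w.2.

(* The norm of A^p_mu; the factor pi^-1 comes from ds = pi^-1 dx dy. *)
Definition bergman_norm p mu f : \bar R :=
  ((pi^-1)%:E *
   \int[@lebesgue_measure R \x @lebesgue_measure R]_(w in complex_of @^-1` disc)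
      ((normc (f (complex_of w))) `^ p * (1 - normc (complex_of w)) `^ mu)%:E)%E
  `^ p^-1.

Definition bergman_set p mu : set (R[i] -> R[i]^o) :=
  [set f | analytic_on_disc f /\ (bergman_norm p mu f < +oo)%E].

(* The integral of f along the segment [0, z], parametrized by t |-> t z. *)
Definition segment_integral z f : R[i] :=
  z * ((\int[@lebesgue_measure R]_(t in `[0, 1]) complex.Re (f (t%:C * z))) +i*
       (\int[@lebesgue_measure R]_(t in `[0, 1]) complex.Im (f (t%:C * z)))).

(* The Cesaro operator on H(D), the value off D being the extension by 0. *)
Definition cesaro_op f : R[i] -> R[i]^o := fun z =>
  if normc z < 1 then
    if z == 0 then f 0
    else z^-1 * segment_integral z (fun zeta => f zeta / (1 - zeta))
  else 0.
End disc.

Section measurability.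
Variable R : realType.

Lemma open_prod_measurable (U : set (R * R)) : open U -> measurable U.
Proof.
move=> oU.
pose box (q : (rat * rat) * (rat * rat)) : set (R * R) :=
  `]ratr q.1.1, ratr q.1.2[ `*` `]ratr q.2.1, ratr q.2.2[.
have -> : U = \bigcup_(q : (rat * rat) * (rat * rat))
    (if `[< box q `<=` U >] then box q else set0).
  apply/seteqP; split => [w Uw|w [q _]]; last first.
    by case: asboolP => // + bw; apply.
  have : nbhs w U by apply: open_nbhs_nbhs.
  rewrite -nbhs_ballE => -[e /= e0 eU].
  have rI (x : R) : exists q : rat * rat,
      (x - e < ratr q.1 < x) /\ (x < ratr q.2 < x + e).
    have /rat_in_itvoo[q1 h1] : x - e < x by rewrite ltrBlDr ltrDl.
    have /rat_in_itvoo[q2 h2] : x < x + e by rewrite ltrDl.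
    by exists (q1, q2); move: h1 h2; rewrite !in_itv.
  have [q1 [/andP[a1 a2] /andP[a3 a4]]] := rI w.1.
  have [q2 [/andP[b1 b2] /andP[b3 b4]]] := rI w.2.
  have sub : box (q1, q2) `<=` U.
    move=> [x y] /= [/= ]; rewrite !in_itv/= => /andP[x1 x2] /andP[y1 y2].
    apply: eU; split; rewrite /= /ball /= ltr_distl; apply/andP; split; lra.
  exists (q1, q2) => //; case: asboolP => // _.
  by split; rewrite /= in_itv/= ?a2 ?b2.
apply: countable_bigcupT_measurable => // q.
by case: asboolP => // _; apply: measurableX; exact: measurable_itv.
Qed.

Lemma continuous_prod_measurable (D : set (R * R)) (h : R * R -> R) :
  open D -> (forall w, D w -> {for w, continuous h}) -> measurable_fun D h.
Proof.
move=> oD ch.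
apply: (measurability _ (RGenOpens.measurableE R)).
move=> _ [_ [a [b ->] <-]]; apply: open_prod_measurable.
rewrite openE => w [Dw hw]; apply: filterI; first exact: open_nbhs_nbhs.
by apply: (ch w Dw); apply: open_nbhs_nbhs; split => //; exact: interval_open.
Qed.

Lemma normc_complex (a b : R) : normc (a +i* b) <= `|a| + `|b|.
Proof.
rewrite /normc /= -(ler_pXn2r (n := 2)) ?nnegrE ?sqrtr_ge0 ?addr_ge0//.
rewrite sqr_sqrtr ?addr_ge0 ?sqr_ge0//.
rewrite sqrrD !real_normK ?num_real// lerD2r lerDl.
by rewrite mulrn_wge0// mulr_ge0.
Qed.

Lemma normc_ge0 (z : R[i]) : 0 <= normc z.
Proof. by case: z => a b; exact: sqrtr_ge0. Qed.

Lemma continuous_complex_of : continuous (@complex_of R : R * R -> R[i]^o).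
Proof.
move=> w U; rewrite -nbhs_ballE => -[e /= e0 eU].
have er : e = (complex.Re e)%:C.
  by move: e0; case: (e) => a b; rewrite ltcE/= => /andP[/eqP -> _].
have re0 : 0 < complex.Re e by move: e0; rewrite er ltcR.
rewrite -nbhs_ballE; exists (complex.Re e / 2); rewrite /= ?divr_gt0//.
move=> v [/= h1 h2]; apply: eU; rewrite /ball /= er.
move: h1 h2; rewrite /ball /= => h1 h2.
change (`|complex_of w - complex_of v|)
  with (normc (complex_of w - complex_of v))%:C.
rewrite ltcR; apply: le_lt_trans (normc_complex _ _) _ => /=.
by rewrite (splitr (complex.Re e)) ltrD.
Qed.

Lemma continuous_normc : continuous (@normc R : R[i]^o -> R).
Proof.
move=> z U; rewrite -nbhs_ballE => -[e /= e0 eU].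
rewrite -nbhs_ballE; exists (e%:C) => /=; first by rewrite ltcR.
move=> y; rewrite /ball /= => h; have : normc (z - y) < e by rewrite -ltcR.
move=> h'; apply: eU; rewrite /ball /=; apply: le_lt_trans h'.
rewrite ler_norml; apply/andP; split.
  rewrite lerNl opprB lerBlDr -(normcN (z - y)) opprB.
  by have := le_normcD (y - z) z; rewrite subrK.
by rewrite lerBlDr; have := le_normcD (z - y) y; rewrite subrK.
Qed.

End measurability.

Section closure.
Variable R : realType.
Implicit Types (f g : R[i] -> R[i]^o) (p mu nu : R).

Let mu2 := (@lebesgue_measure R \x @lebesgue_measure R)%E.
Let disc2 : set (R * R) := @complex_of R @^-1` disc (R := R).

Let integrand p mu f (w : R * R) : R :=
  (normc (f (complex_of w))) `^ p * (1 - normc (complex_of w)) `^ mu.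

Let integrand_ge0 p mu f w : (0 <= (integrand p mu f w)%:E)%E.
Proof. by rewrite lee_fin mulr_ge0// powR_ge0. Qed.

Lemma bergman_norm_lty p mu f : 0 < p ->
  (bergman_norm p mu f < +oo)%E <->
  (\int[mu2]_(w in disc2) (integrand p mu f w)%:E < +oo)%E.
Proof.
move=> p0.
have pi0 : 0 < pi^-1 :> R by rewrite invr_gt0 pi_gt0.
rewrite /bergman_norm -/mu2 -/disc2.
have := integral_ge0 mu2
  (fun (w : R * R) (_ : disc2 w) => integrand_ge0 p mu f w).
rewrite /integrand; case: (integral _ _ _) => [r|_|//] //=.
  by rewrite ?poweR_EFin; split => _; rewrite ltry.
by rewrite mulry gtr0_sg// mul1e /= invr_eq0 (gt_eqF p0).
Qed.

Lemma open_disc2 : open disc2.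
Proof.
rewrite openE => w dw.
have /continuous_complex_of : nbhs (complex_of w : R[i]^o) (disc (R := R)).
  apply: (@continuous_normc R (complex_of w) [set x | x < 1]).
  by apply: open_nbhs_nbhs; split => //; exact: open_lt.
by [].
Qed.

Let disc2_measurable : measurable disc2.
Proof. by apply: open_prod_measurable; exact: open_disc2. Qed.

Lemma integrand_measurable p mu f : analytic_on_disc f ->
  measurable_fun disc2 (fun w => (integrand p mu f w)%:E).
Proof.
move=> [df _]; apply/measurable_EFinP; apply: measurable_funM.
  apply: (measurableT_comp (measurable_powR p)).
  apply: continuous_prod_measurable; first exact: open_disc2.
  move=> w dw; apply: (continuous_comp (g := @normc R : R[i]^o -> R));
    last exact: continuous_normc.
  apply: (continuous_comp (f := @complex_of R : R * R -> R[i]^o)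
    (g := f : R[i]^o -> R[i]^o)); first exact: continuous_complex_of.
  apply: differentiable_continuous; apply/derivable1_diffP; exact: df.
apply: (measurableT_comp (measurable_powR mu)).
apply: measurable_funB => //.
apply: continuous_prod_measurable; first exact: open_disc2.
move=> w dw; apply: (continuous_comp (f := @complex_of R : R * R -> R[i]^o)
  (g := @normc R : R[i]^o -> R)); first exact: continuous_complex_of.
exact: continuous_normc.
Qed.

Lemma analytic_on_disc0 : analytic_on_disc (0 : R[i] -> R[i]^o).
Proof. by split => // z dz; exact: derivable_cst. Qed.

Lemma analytic_on_discP (a : R[i]) f g :
  analytic_on_disc f -> analytic_on_disc g -> analytic_on_disc (a *: f + g).
Proof.
move=> [df f0] [dg g0]; split => z dz.
  apply: derivableD; last exact: dg.
  by apply: derivableZ; exact: df.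
by rewrite !fctE/= f0// g0// scaler0 addr0.
Qed.

Lemma bergman_set0 p mu : 0 < p -> bergman_set p mu (0 : R[i] -> R[i]^o).
Proof.
move=> p0; split; first exact: analytic_on_disc0.
apply/(bergman_norm_lty _ _ p0); rewrite integral0_eq// => w _.
have e : normc ((0 : R[i] -> R[i]^o) (complex_of w)) = 0 := @normc0 R.
by rewrite /integrand e powR0 ?gt_eqF// mul0r.
Qed.

Let powR_normcD p (a x y : R[i]) : 0 < p ->
  normc (a * x + y) `^ p <=
  2 `^ p * (normc a `^ p * normc x `^ p + normc y `^ p).
Proof.
move=> p0; rewrite -powRM ?normc_ge0// -normcM; set u := a * x.
have key (b c : R) : 0 <= b -> b <= c -> 2 `^ p * c `^ p =  (2 * c) `^ p.
  by move=> b0 bc; rewrite powRM// (le_trans b0).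
have := le_normcD u y; have u0 := normc_ge0 u; have y0 := normc_ge0 y.
have uy0 := normc_ge0 (u + y).
move: (normc (u + y)) (normc u) (normc y) u0 y0 uy0 => s b c b0 c0 s0 sbc.
have [bc|/ltW cb] := leP b c.
  apply: (@le_trans _ _ (2 `^ p * c `^ p)).
    rewrite (key b)//; apply: ge0_ler_powR; rewrite ?nnegrE ?(ltW p0)//.
      by rewrite mulr_ge0.
    by apply: le_trans sbc _; rewrite mulr_natl mulr2n lerD2r.
  by rewrite ler_wpM2l ?powR_ge0// lerDr powR_ge0.
apply: (@le_trans _ _ (2 `^ p * b `^ p)).
  rewrite (key c)//; apply: ge0_ler_powR; rewrite ?nnegrE ?(ltW p0)//.
    by rewrite mulr_ge0.
  by apply: le_trans sbc _; rewrite mulr_natl mulr2n lerD2l.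
by rewrite ler_wpM2l ?powR_ge0// lerDl powR_ge0.
Qed.

Lemma bergman_setP p mu (a : R[i]) f g : 0 < p ->
  bergman_set p mu f -> bergman_set p mu g -> bergman_set p mu (a *: f + g).
Proof.
move=> p0 [af nf] [ag ng]; split; first exact: analytic_on_discP.
move: nf ng => /(bergman_norm_lty _ _ p0) nf /(bergman_norm_lty _ _ p0) ng.
apply/(bergman_norm_lty _ _ p0).
apply: (@le_lt_trans _ _ (\int[mu2]_(w in disc2)
  ((2 `^ p * normc a `^ p)%:E * (integrand p mu f w)%:E +
   (2 `^ p)%:E * (integrand p mu g w)%:E))%E).
  apply: ge0_le_integral => //.
  - by apply: integrand_measurable; exact: analytic_on_discP.
  - by apply: emeasurable_funD; apply: measurable_funeM;
      exact: integrand_measurable.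
  move=> w _; rewrite -!EFinM -EFinD lee_fin /integrand.
  rewrite !mulrA -mulrDl ler_wpM2r ?powR_ge0//.
  by rewrite -mulrA -mulrDr; exact: powR_normcD.
rewrite ge0_integralD//.
- rewrite ge0_integralZl//; [|exact: integrand_measurable
    |by rewrite lee_fin mulr_ge0 ?powR_ge0].
  rewrite ge0_integralZl//; last exact: integrand_measurable.
  apply: lte_add_pinfty; apply: lte_mul_pinfty.
  + by rewrite lee_fin mulr_ge0 ?powR_ge0.
  + by [].
  + exact: nf.
  + by rewrite lee_fin powR_ge0.
  + by [].
  + exact: ng.
- by move=> w _; rewrite mule_ge0// lee_fin mulr_ge0 ?powR_ge0.
- by apply: measurable_funeM; exact: integrand_measurable.
- by move=> w _; rewrite mule_ge0// lee_fin powR_ge0.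
- by apply: measurable_funeM; exact: integrand_measurable.
Qed.

Lemma bergman_set_le p mu nu : 0 < p -> mu <= nu ->
  bergman_set p mu `<=` bergman_set (R := R) p nu.
Proof.
move=> p0 munu f [af nf]; split; first exact: af.
move/(bergman_norm_lty _ _ p0): nf => nf; apply/(bergman_norm_lty _ _ p0).
apply: le_lt_trans nf; apply: ge0_le_integral => //;
  [exact: integrand_measurable|exact: integrand_measurable|].
move=> w dw; rewrite lee_fin ler_wpM2l ?powR_ge0//.
by apply: ger_powR munu; rewrite subr_gt0 dw lerBlDr lerDl normc_ge0.
Qed.

End closure.

Section submodule.
Variables (K : nzRingType) (V : lmodType K) (S : set V).

Definition submodule_pred & GRing.submod_closed (fun v : V => v \in S)
  : V -> bool := fun v => v \in S.

Variable S_closed : GRing.submod_closed (fun v : V => v \in S).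

HB.instance Definition _ := GRing.isSubmodClosed.Build K V
  (submodule_pred S_closed) (GRing.submod_closed_semi S_closed).

Record submodule : Type := Submodule {
  submodule_val :> V ;
  _ : submodule_val \in submodule_pred S_closed }.

HB.instance Definition _ := [isSub for submodule_val].
HB.instance Definition _ := [Choice of submodule by <:].
HB.instance Definition _ := [SubChoice_isSubLmodule of submodule by <:].

Definition restricts_to (C : V -> V) (T : submodule -> submodule) : Prop :=
  forall f : submodule, submodule_val (T f) = C (submodule_val f).

End submodule.

Section locally_convex.
Variables (K : numFieldType) (E : lmodType K).

(* The axioms of tvsType, for an arbitrary topology tau on E. *)
Definition locally_convex_topology (tau : Topological E) : Prop :=
  let T : topologicalType := Topological.Pack tau in
  [/\ continuous ((fun x => (x.1 : E) + (x.2 : E)) : T * T -> T),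
      continuous ((fun x => x.1 *: (x.2 : E)) : K^o * T -> T)
    & exists2 B : set_system T,
        (forall b, b \in B -> convex_set (b : set E)) & basis B].

(* The coarsest topology on E making all the u i continuous. *)
Definition projective_limit (I : Type) (X : I -> topologicalType)
    (u : forall i, E -> X i) : topologicalType :=
  sup_topology (fun i => Topological.on (initial_topology (u i))).

(* The finest locally convex topology on E making all the u i continuous, as the
   supremum of all the locally convex topologies that do. sup_topology cannot
   take the family of these topologies as its index type (universes), hence the
   subbase of all their open sets. *)
Definition inductive_limit (I : Type) (X : I -> topologicalType)
  (u : forall i, X i -> E) : Type := E.

Definition inductive_limit_subbase (I : Type) (X : I -> topologicalType)
    (u : forall i, X i -> E) : set (set E) :=
  [set U : set E | exists tau : Topological E,
    let T : topologicalType := Topological.Pack tau in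
    [/\ locally_convex_topology tau, forall i, continuous (u i : X i -> T)
      & open (U : set T)]].

HB.instance Definition _ I X u := Choice.on (@inductive_limit I X u).
HB.instance Definition _ I X u := isSubBaseTopological.Build
  (@inductive_limit I X u) (@inductive_limit_subbase I X u) id.

End locally_convex.

Definition is_isomorphism (K : numFieldType) (E : preTopologicalLmodType K)
    (T : E -> E) : Prop :=
  [/\ linear T, continuous T
    & exists S : E -> E, [/\ cancel T S, cancel S T & continuous S]].

Section bergman.
Variables (R : realType) (p : R) (p1 : 1 < p).
Implicit Types mu alpha : R.

Definition bergman_plus_set alpha : set (R[i] -> R[i]^o) :=
  \bigcap_(mu in [set mu | alpha < mu]) bergman_set p mu.

Definition bergman_minus_set alpha : set (R[i] -> R[i]^o) :=
  \bigcup_(mu in [set mu | 0 < mu < alpha]) bergman_set p mu.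

Let p0 : 0 < p. Proof. exact: lt_trans ltr01 p1. Qed.

Lemma bergman_closed mu : GRing.submod_closed (fun f => f \in bergman_set p mu).
Proof.
split; first exact/mem_set/bergman_set0.
by move=> a f g /set_mem fA /set_mem gA; exact/mem_set/bergman_setP.
Qed.

Lemma bergman_plus_closed alpha :
  GRing.submod_closed (fun f => f \in bergman_plus_set alpha).
Proof.
split; first by apply/mem_set => mu _; exact: bergman_set0.
move=> a f g /set_mem fA /set_mem gA; apply/mem_set => mu amu.
by apply: bergman_setP; [|exact: fA|exact: gA].
Qed.

Lemma bergman_minus_closed alpha : 0 < alpha ->
  GRing.submod_closed (fun f => f \in bergman_minus_set alpha).
Proof.
move=> a0; split.
  apply/mem_set; exists (alpha / 2); last exact: bergman_set0.
  by rewrite /= divr_gt0//= ltr_pdivrMr// ltr_pMr// ltr1n.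
move=> a f g /set_mem[mu mua fA] /set_mem[nu nua gA].
apply/mem_set; exists (Num.max mu nu).
  move: mua nua => /= /andP[mu0 mua] /andP[_ nua].
  by rewrite lt_max mu0/= gt_max mua.
have [mu_le nu_le] : mu <= Num.max mu nu /\ nu <= Num.max mu nu.
  by rewrite !le_max !lexx orbT.
by apply: (bergman_setP a p0);
  [exact: bergman_set_le fA|exact: bergman_set_le gA].
Qed.

Definition bergman mu : Type := submodule (bergman_closed mu).

HB.instance Definition _ mu :=
  GRing.Lmodule.copy (bergman mu) (submodule (bergman_closed mu)).

Definition bergman_ball mu (f : bergman mu) (r : R) : set (bergman mu) :=
  [set g | (bergman_norm p mu (submodule_val (g - f)%R) < r%:E)%E].

(* The norm topology of A^p_mu. *)
HB.instance Definition _ mu := isSubBaseTopological.Build (bergman mu)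
  [set B | exists (f : bergman mu) (r : R), 0 < r /\ B = bergman_ball f r] id.

Section plus.
Variable alpha : R.

Definition bergman_plus : Type := submodule (bergman_plus_closed alpha).

HB.instance Definition _ :=
  GRing.Lmodule.copy bergman_plus (submodule (bergman_plus_closed alpha)).

Lemma bergman_plus_sub mu (f : bergman_plus) : alpha < mu ->
  submodule_val f \in bergman_set p mu.
Proof.
by case: f => f fA amu; apply/mem_set; exact: (set_mem fA) amu.
Qed.

Lemma ltr_addV n : alpha < alpha + n.+1%:R^-1.
Proof. by rewrite ltrDl invr_gt0. Qed.

Definition bergman_plus_incl (n : nat) (f : bergman_plus) :
    bergman (alpha + n.+1%:R^-1) :=
  Submodule (S_closed := bergman_closed _) (bergman_plus_sub f (ltr_addV n)).

HB.instance Definition _ :=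
  Topological.copy bergman_plus (projective_limit bergman_plus_incl).

End plus.

Section minus.
Variables (alpha : R) (alpha0 : 0 < alpha).

Definition bergman_minus : Type := submodule (bergman_minus_closed alpha0).

HB.instance Definition _ :=
  GRing.Lmodule.copy bergman_minus (submodule (bergman_minus_closed alpha0)).

Lemma bergman_minus_sup mu (f : bergman mu) : 0 < mu < alpha ->
  submodule_val f \in bergman_minus_set alpha.
Proof.
by case: f => f fA mua; apply/mem_set; exists mu => //; exact: set_mem fA.
Qed.

Definition bergman_minus_incl (mu : {mu : R | 0 < mu < alpha})
    (f : bergman (sval mu)) : bergman_minus :=
  Submodule (S_closed := bergman_minus_closed alpha0)
    (bergman_minus_sup f (svalP mu)).

HB.instance Definition _ :=
  Topological.copy bergman_minus (inductive_limit bergman_minus_incl).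

End minus.

End bergman.

(* Main.v *)
Require Import Defs.
From mathcomp Require Import all_boot all_order all_algebra.
From mathcomp Require Import complex.
From mathcomp Require Import all_classical all_reals all_analysis.
From mathcomp Require Import ring lra.

(* C(f) = g forces f(z) = (1 - z) (z g(z))' off the origin. Both spaces contain
   the bounded function sqrt(1 + z) and lie in some A^p_nu. If C were onto,
   taking n preimages in a row would produce functions
   sqrt(1 + z) (1 + z)^-n P_n(z) in the space, with polynomials P_n that do not
   vanish at -1; for large n such a singularity at -1 is not in A^p_nu. So C is
   not even surjective, and the topologies play no role. *)

Set Implicit Arguments.
Unset Strict Implicit.
Unset Printing Implicit Defensive.

Import Order.TTheory GRing.Theory Num.Theory.
Import numFieldNormedType.Exports.
Import ComplexField.Normc.

Local Open Scope classical_set_scope.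
Local Open Scope complex_scope.
Local Open Scope ring_scope.

(** * Derivatives of square root branches, polynomials and negative powers of 1 + x *)

Section complex_derivative.
Context {K : numFieldType}.

(** The identity (q z - q x) (q x + q z) = z - x, divided by the second factor, gives |q z - q x| <=
    |z - x| / c. The lower bound c on that factor keeps q from jumping to the opposite root. *)
Lemma sqrt_branch_continuous (q : K -> K) (z c : K) : 0 < c ->
  (\forall x \near z, q x ^+ 2 = 1 + x /\ c <= `|q x + q z|) ->
  {for z, continuous q}.
Proof.
move=> c0 qz; have F := nbhs_filter z.
apply/cvgrPdist_le => e e0.
have [q2 _] : q z ^+ 2 = 1 + z /\ c <= `|q z + q z|.
  exact: (@nbhs_singleton K z _ qz).
near=> x.
have [qx cx] : q x ^+ 2 = 1 + x /\ c <= `|q x + q z| by near: x.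
rewrite -(ler_pM2r c0) (le_trans (ler_wpM2l _ cx))//.
rewrite -normrM.
have -> : (q z - q x) * (q x + q z) = z - x.
  by rewrite [q x + _]addrC -subr_sqr q2 qx; ring.
by near: x; apply: cvgr_dist_le => //; rewrite mulr_gt0.
Unshelve. all: by end_near. Qed.

(** By the same identity the difference quotient is 1 / (q (z + h) + q z), which tends to 1 / (2 q
    z). The limit is written with q z in the numerator so that q factors out of derivatives of
    products. *)
Lemma sqrt_branch_is_derive (q : K -> K) (z c : K) : 0 < c ->
  (\forall x \near z, q x ^+ 2 = 1 + x /\ c <= `|q x + q z|) ->
  is_derive z 1 q (q z / (2 * (1 + z))).
Proof.
move=> c0 qz.
have [q2 cz] : q z ^+ 2 = 1 + z /\ c <= `|q z + q z|.
  exact: (@nbhs_singleton K z _ qz).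
have qq0 : q z + q z != 0 by rewrite -normr_gt0 (lt_le_trans c0).
have q0 : q z != 0 by apply: contra_neq qq0 => ->; rewrite addr0.
have -> : q z / (2 * (1 + z)) = (q z + q z)^-1.
  by rewrite -q2; field; rewrite qq0 q0.
have hz : (fun h : K => h + z) @ (0 : K) --> z.
  rewrite -[X in _ --> X]add0r.
  exact: (@cvgD K K K (nbhs (0 : K)) (nbhs_filter (0 : K)) id (cst z) 0 z
    (@cvg_id K _) (@cvg_cst K _ _ (nbhs (0 : K)) _)).
have H : (fun h => h^-1 *: ((q \o shift z) (h *: 1) - q z)) @ 0^' -->
   (q z + q z)^-1.
  have : (fun h => (q (h + z) + q z)^-1) @ 0^' --> (q z + q z)^-1.
    apply: cvgV => //; apply: cvgD; last exact: cvg_cst.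
    apply: cvg_within_filter.
    apply: (cvg_comp _ _ hz); exact: sqrt_branch_continuous qz.
  apply: cvg_trans; apply: near_eq_cvg.
  have : \forall h \near 0^', q (h + z) ^+ 2 = 1 + (h + z) /\
      c <= `|q (h + z) + q z|.
    exact: (@cvg_within K (nbhs (0 : K)) _ _ _ (hz _ qz)).
  apply: filterS2 (nbhs_dnbhs_neq 0) => h h0 [h2 ch].
  rewrite /= -[_ *: _]/(_ * _) [h *: 1]mulr1.
  have s0 : q (h + z) + q z != 0 by rewrite -normr_gt0 (lt_le_trans c0).
  suff -> : q (h + z) - q z = h / (q (h + z) + q z) by rewrite mulKf.
  by apply: (mulIf s0); rewrite mulfVK// -subr_sqr h2 q2; ring.
apply: DeriveDef; first by apply/cvg_ex; eexists; exact: H.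
exact: cvg_lim H.
Unshelve. all: by end_near. Qed.

Lemma is_derive_horner (P : {poly K}) (z : K) :
  is_derive z 1 (horner P) P^`().[z].
Proof.
elim/poly_ind: P => [|P c ih].
  rewrite deriv0 horner0; have -> : horner (0 : {poly K}) = cst 0.
    by apply/funext => y; rewrite horner0.
  exact: is_derive_cst.
have -> : horner (P * 'X + c%:P) = horner P * id + cst c.
  by apply/funext => y; rewrite !hornerE.
apply: is_derive_eq.
rewrite derivMXaddC !hornerE -[_%:A]/(_ * _) -[z *: _]/(_ * _).
by rewrite mulr1 [z * _]mulrC.
Qed.

Lemma is_derive_invXn (n : nat) (z : K) : 1 + z != 0 ->
  is_derive z 1 (fun x => (1 + x) ^- n) (- n%:R * (1 + z) ^- n.+1).
Proof.
move=> z0.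
have -> : (fun x : K => (1 + x) ^- n) = (fun x : K => (1 + x)^-1) ^+ n.
  by apply/funext => x; rewrite fctE exprVn.
have D : is_derive z 1 (fun x : K => 1 + x) (1 : K).
  have -> : (fun x : K => 1 + x) = cst 1 + id by [].
  by apply: is_derive_eq; rewrite add0r.
have DV : is_derive z 1 (fun x : K => (1 + x)^-1) (- (1 + z) ^- 2).
  apply: DeriveDef; first exact: derivableV.
  by rewrite deriveV// derive_val -[_ *: _]/(_ * _) mulr1.
apply: is_derive_eq; rewrite -[_ *: _]/(_ * _).
case: n => [|n]; first by rewrite oppr0 !mul0r.
by rewrite /= -!exprVn mulrN mulNr -mulrA -exprD addn2.
Qed.

End complex_derivative.

(** * Rescaling of integrals, and continuity along rays *)

Section real_line.
Context {R : realType}.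
Let leb := @lebesgue_measure R.

(** Substituting t r for t moves the parameter from the integrand to the upper endpoint, where the
    fundamental theorem of calculus can differentiate with respect to it. *)
Lemma Rintegral_scale (a : R -> R) (r : R) : 0 < r ->
  {in `[0, r]%classic, continuous a} ->
  r * (\int[leb]_(t in `[0, 1]) a (t * r)) = \int[leb]_(t in `[0, r]) a t.
Proof.
move=> r0 ca.
have dF (t : R) : is_derive t 1 (fun t => t * r) r.
  have -> : (fun t : R => t * r) = id * cst r by [].
  apply: is_derive_eq; rewrite scaler0 add0r.
  by rewrite -[_ *: _]/(_ * _) mulr1.
have F'E : ((fun t : R => t * r)^`())%classic = cst r.
  by apply/funext => t; rewrite derive1E derive_val.
have cF : continuous (fun t : R => t * r).
  by move=> t; apply/differentiable_continuous/derivable1_diffP.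
have iar : leb.-integrable `[0, 1] (EFin \o (fun t => a (t * r))).
  apply: continuous_compact_integrable; first exact: segment_compact.
  apply: continuous_in_subspaceT => t /[!inE]/=.
  rewrite in_itv/= => /andP[t0 t1].
  apply: (continuous_comp (cF t)); apply: ca.
  by rewrite inE/= in_itv/= mulr_ge0 ?(ltW r0)//= ler_piMl// ltW.
have := @integration_by_substitution_increasing R (fun t => t * r) a 0 1.
rewrite mul0r mul1r F'E => /(_ ler01); rewrite /Rintegral => ->.
- rewrite /Rintegral.
  have /= <- := fineM (x := r%:E) _ _; last 2 first.
  - by [].
  - exact: integrable_fin_num iar.
  congr fine; rewrite -integralZl//.
    by apply: eq_integral => t _; rewrite /= -EFinM mulrC.
- by move=> x y _ _ xy; rewrite ltr_pM2r.
- by move=> x _; exact: cvg_cst.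
- exact: is_cvg_cst.
- exact: is_cvg_cst.
- split => //.
  + by apply: cvg_at_right_filter; exact: cF.
  + by apply: cvg_at_left_filter; exact: cF.
- exact: continuous_in_subspaceT.
Qed.

Lemma Re_continuous : continuous (@complex.Re R : R[i]^o -> R).
Proof.
move=> z U; rewrite -nbhs_ballE => -[e /= e0 eU].
rewrite -nbhs_ballE; exists (e%:C) => /=; first by rewrite ltcR.
move=> y; rewrite /ball /= => h; apply: eU; rewrite /ball/=.
rewrite -raddfB -ltcR; exact: le_lt_trans (normc_ge_Re _) h.
Qed.

Lemma Im_continuous : continuous (@complex.Im R : R[i]^o -> R).
Proof.
move=> z U; rewrite -nbhs_ballE => -[e /= e0 eU].
rewrite -nbhs_ballE; exists (e%:C) => /=; first by rewrite ltcR.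
move=> y; rewrite /ball /= => h; apply: eU; rewrite /ball/=.
rewrite -raddfB -ltcR -normrN -ReiNIm; apply: le_lt_trans (normc_ge_Re _) _.
by rewrite normrM -[X in _ * X]/(normc _)%:C /= expr0n expr1n add0r sqrtr1
  mulr1.
Qed.

Lemma ray_continuous (z : R[i]) :
  continuous ((fun t : R => t%:C * z) : R -> R[i]^o).
Proof.
move=> t.
have -> : (fun t : R => t%:C * z) =
    @complex_of R \o (fun t : R => (t * complex.Re z, t * complex.Im z)).
  by apply/funext => s; rewrite /complex_of/=; case: z => a b; simpc.
apply: continuous_comp; last exact: continuous_complex_of.
have M (b : R) : (fun s : R => s * b) @ t --> t * b.
  by apply: cvgMr_tmp; exact: cvg_id.
exact: (cvg_pair (M (complex.Re z)) (M (complex.Im z))).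
Qed.

End real_line.

(** * Inverting the Cesàro operator by differentiating along rays *)

Section cesaro.
Context {R : realType}.
Let leb := @lebesgue_measure R.
Implicit Types (f : R[i] -> R[i]^o) (z : R[i]).

Lemma normc_real (r : R) : 0 <= r -> normc (r%:C) = r.
Proof. by move=> r0; rewrite /normc/= expr0n/= addr0 sqrtr_sqr ger0_norm. Qed.

Lemma disc_add1_neq0 z : disc z -> 1 + z != 0.
Proof.
rewrite /disc/=; apply: contraTneq => /eqP.
by rewrite addrC addr_eq0 => /eqP ->; rewrite normcN normc1 ltxx.
Qed.

Lemma disc_sub1_neq0 z : disc z -> 1 - z != 0.
Proof.
by rewrite /disc/=; apply: contraTneq => /subr0_eq <-; rewrite normc1 ltxx.
Qed.

Lemma disc_scale z (t r : R) : 0 <= t <= r ->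
  disc (r%:C * z) -> disc (t%:C * z).
Proof.
move=> /andP[t0 tr]; rewrite /disc/= !normcM !normc_real ?(le_trans t0)//.
by apply: le_lt_trans; rewrite ler_wpM2r// normc_ge0.
Qed.

Lemma disc_open : open (@disc R : set R[i]^o).
Proof.
by apply: (open_comp (f := @normc R : R[i]^o -> R) (D := [set x | x < 1]));
  [move=> z _; exact: continuous_normc|exact: open_lt].
Qed.

(** The integrand of C f on the ray through z, as a function of the real parameter t; the factor z
    from dzeta = z dt is left out. *)
Definition cesaro_integrand f z (t : R) : R[i]^o :=
  f (t%:C * z) / (1 - t%:C * z).

Lemma cesaro_integrand_continuous f z (t : R) : analytic_on_disc f ->
  disc (t%:C * z) -> {for t, continuous (cesaro_integrand f z)}.
Proof.
move=> [df _] tz.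
pose F := (fun w : R[i]^o => f w / (1 - w) : R[i]^o).
apply: (@continuous_comp _ _ _ ((fun t : R => t%:C * z) : R -> R[i]^o) F).
  exact: ray_continuous.
rewrite /F; apply: (@continuousM R[i] R[i]^o f (fun w => (1 - w)^-1)).
  by apply/differentiable_continuous/derivable1_diffP; exact: df.
apply: (@continuousV R[i] R[i]^o (fun w => 1 - w)).
  exact: disc_sub1_neq0.
apply: (@continuousB R[i] R[i]^o R[i]^o (cst 1) id).
  exact: cst_continuous.
exact: cvg_id.
Qed.

(** With z fixed and r moving, x C(f)(x) at x = r z becomes a real integral with variable endpoint
    r. *)
Lemma cesaro_op_ray f z (r : R) : analytic_on_disc f -> z != 0 -> 0 < r ->
  disc (r%:C * z) ->
  r%:C * z * cesaro_op f (r%:C * z) =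
  z * ((\int[leb]_(t in `[0, r]) complex.Re (cesaro_integrand f z t)) +i*
       (\int[leb]_(t in `[0, r]) complex.Im (cesaro_integrand f z t))).
Proof.
move=> af z0 r0 rz.
have rz0 : r%:C * z != 0.
  by rewrite mulf_neq0// eq_complex/= gt_eqF.
rewrite /cesaro_op rz (negbTE rz0) mulrA mulfV// mul1r /segment_integral.
rewrite [r%:C * z]mulrC -mulrA; congr (_ * _).
have scale (g : R[i]^o -> R) : continuous g ->
    r * (\int[leb]_(t in `[0, 1])
      g (f (t%:C * (z * r%:C)) / (1 - t%:C * (z * r%:C)))) =
    \int[leb]_(t in `[0, r]) g (cesaro_integrand f z t).
  move=> cg; rewrite -(@Rintegral_scale _ (g \o cesaro_integrand f z))//.
    congr (_ * _); apply: eq_Rintegral => t _ /=; congr g.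
    by rewrite /cesaro_integrand rmorphM/= -mulrA [r%:C * z]mulrC.
  move=> t /[!inE]/=; rewrite in_itv/= => tr.
  apply: (@continuous_comp _ _ _ (cesaro_integrand f z) g); last exact: cg.
  by apply: cesaro_integrand_continuous => //; exact: disc_scale rz.
rewrite -(scale _ Re_continuous) -(scale _ Im_continuous).
by move: (Rintegral _ _ _) (Rintegral _ _ _) => A B; simpc.
Qed.

Lemma cesaro_integral_derivative f z (g : R[i]^o -> R) : analytic_on_disc f ->
  disc z -> continuous g ->
  let I (r : R) := \int[leb]_(t in `[0, r]) g (cesaro_integrand f z t) in
  h^-1 * (I (1 + h) - I 1) @[h --> 0^'] --> g (cesaro_integrand f z 1).
Proof.
move=> af dz cg I.
(* This u satisfies u > 1 and u |z| < 1: the point 1 is interior to [0, u], and the segment from 0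
   to u z stays in the disc. *)
pose u := 2 / (1 + normc z).
have z0 := normc_ge0 z.
have z1 : normc z < 1 := dz.
have z2 : 0 < 1 + normc z by lra.
have u1 : 1 < u by rewrite ltr_pdivlMr//; lra.
have dt (t : R) : 0 <= t <= u -> disc (t%:C * z).
  move=> tu; apply: (disc_scale tu).
  rewrite /disc/= normcM normc_real ?(le_trans ler01) ?(ltW u1)//.
  by rewrite /u mulrAC ltr_pdivrMr//; lra.
have cgI (t : R) : 0 <= t <= u ->
    {for t, continuous (g \o cesaro_integrand f z)}.
  move=> /dt tz; apply: continuous_comp; last exact: cg.
  exact: cesaro_integrand_continuous.
have int : leb.-integrable `[0, u] (EFin \o (g \o cesaro_integrand f z)).
  apply: continuous_compact_integrable; first exact: segment_compact.
  apply: continuous_in_subspaceT => t /[!inE]/=; rewrite in_itv/=.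
  exact: cgI.
have [dI I'] := continuous_FTC1_closed u1 int ltr01
  (cgI 1 (introT andP (conj ler01 (ltW u1)))).
rewrite -[g _]I' derive1E; move: dI; rewrite /derivable /derive.
have -> : (fun h => h^-1 *: ((I \o shift 1) (h *: 1) - I 1)) =
          (fun h => h^-1 * (I (1 + h) - I 1)).
  by apply/funext => h /=; rewrite [h *: 1]mulr1 [1 + h]addrC.
exact.
Qed.

(** Since x g(x) is assumed to have the complex derivative d at z, d can be computed from increments
    h z with h real. On that ray the fundamental theorem of calculus yields the value f(z) / (1 -
    z). *)
Lemma cesaro_op_inverse f g z d : analytic_on_disc f -> disc z -> z != 0 ->
  (forall x, disc x -> x != 0 -> cesaro_op f x = g x) ->
  is_derive (z : R[i]^o) 1 ((fun x => x * g x) : R[i]^o -> R[i]^o) d ->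
  f z = (1 - z) * d.
Proof.
move=> af dz z0 fg [dG Gd].
pose G : R[i]^o -> R[i]^o := fun x => x * g x.
pose quo (h : R) : R[i]^o := (h%:C * z)^-1 * (G ((1 + h)%:C * z) - G z).
have quod : quo h @[h --> 0^'] --> (d : R[i]^o).
  (* As z is non-zero, h z tends to 0 through non-zero values, so the complex difference quotient
     may be restricted to these increments. *)
  have kz : (h%:C * z : R[i]^o) @[h --> 0^'] --> (0 : R[i]^o)^'.
    have c0 : (h%:C * z : R[i]^o) @[h --> (0 : R)] --> (0 : R[i]^o).
      by have := @ray_continuous R z 0; rewrite /continuous_at mul0r.
    move=> P P0; have {}P0 := c0 _ P0.
    change (\forall h \near (0 : R), h != 0 -> P (h%:C * z)).
    apply: (@filterS R (nbhs (0 : R)) _ _ _ _ P0) => h hP h0; apply: hP.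
    by rewrite mulf_neq0// eq_complex/= negb_and h0.
  have dG' : (fun k : R[i]^o => k^-1 *:
      ((G \o shift (z : R[i]^o)) (k *: 1) - G z)) @ (0 : R[i]^o)^' -->
      (d : R[i]^o).
    by move: dG Gd; rewrite /derivable /derive -/G => dG <-; exact: dG.
  suff -> : quo = (fun k : R[i]^o => k^-1 *: ((G \o shift (z : R[i]^o)) (k *: 1)
      - G z)) \o (fun h : R => h%:C * z) by exact: cvg_comp kz dG'.
  apply/funext => h.
  rewrite /quo/= -[_ *: _]/(_ * _) -[(h%:C * z) *: 1]/(_ * _).
  by rewrite mulr1 [1 + h]addrC rmorphD/= mulrDl mul1r.
pose I (p : R[i]^o -> R) (r : R) :=
  \int[leb]_(t in `[0, r]) p (cesaro_integrand f z t).
(* For small h, 1 + h is positive and (1 + h) z is in the disc, so [cesaro_op_ray] applies at both r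
   = 1 + h and r = 1; the common factor z then cancels. *)
have quoE : \forall h \near 0^', quo h =
    (h^-1 * (I (@complex.Re R) (1 + h) - I (@complex.Re R) 1)) +i*
    (h^-1 * (I (@complex.Im R) (1 + h) - I (@complex.Im R) 1)).
  have near_disc : \forall h \near (0 : R), 0 < 1 + h /\ disc ((1 + h)%:C * z).
    have c1 : (fun h : R => 1 + h) @ (0 : R) --> (1 : R).
      rewrite -[X in _ --> X]addr0.
      exact: (@cvgD R R R (nbhs (0 : R)) (nbhs_filter (0 : R)) (cst 1) id 1 0
        (@cvg_cst R _ _ (nbhs (0 : R)) _) (@cvg_id R _)).
    have c2 : ((1 + h)%:C * z : R[i]^o) @[h --> (0 : R)] --> (z : R[i]^o).
      have := @ray_continuous R z 1; rewrite /continuous_at mul1r.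
      exact: cvg_comp c1.
    have n1 := c1 _ (lt_nbhsr ltr01).
    have n2 : nbhs (z : R[i]^o) (disc (R := R)).
      by apply: open_nbhs_nbhs; split => //; exact: disc_open.
    have {}n2 := c2 _ n2.
    exact: (@filterI R (nbhs (0 : R)) _ _ _ n1 n2).
  apply: filterS2 (nbhs_dnbhs_neq 0)
    (@cvg_within R (nbhs (0 : R)) _ _ _ near_disc) => h h0 [h1 hz].
  have GE r : 0 < r -> disc (r%:C * z) -> G (r%:C * z) =
      z * (I (@complex.Re R) r +i* I (@complex.Im R) r).
    move=> r0 rz; rewrite /G -fg ?(cesaro_op_ray af)//.
    by rewrite mulf_neq0// eq_complex/= gt_eqF.
  have := GE 1 ltr01; rewrite mul1r => /(_ dz) G1.
  rewrite /quo GE// G1.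
  rewrite -mulrBr invfM -mulrA mulKf// -fmorphV.
  by rewrite /I; simpc.
(* Limits are compared for real and imaginary parts separately, the integrals being real. *)
have E (p : R[i]^o -> R) : continuous p ->
    (\forall h \near 0^', p (quo h) = h^-1 * (I p (1 + h) - I p 1)) ->
    p d = p (cesaro_integrand f z 1).
  move=> cp pE.
  have L1 : p (quo h) @[h --> 0^'] --> p d.
    by apply: cvg_comp quod _; exact: cp.
  have L2 : p (quo h) @[h --> 0^'] --> p (cesaro_integrand f z 1).
    have := cesaro_integral_derivative af dz cp.
    apply: cvg_trans; apply: near_eq_cvg.
    by apply: filterS pE => h ->.
  exact: (cvg_unique _ L1 L2).
have dE : d = cesaro_integrand f z 1.
  have Rd : complex.Re d = complex.Re (cesaro_integrand f z 1).
    apply: E; first exact: Re_continuous.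
    by apply: filterS quoE => h ->.
  have Id : complex.Im d = complex.Im (cesaro_integrand f z 1).
    apply: E; first exact: Im_continuous.
    by apply: filterS quoE => h ->.
  by apply/eqP; rewrite eq_complex Rd Id !eqxx.
rewrite dE /cesaro_integrand mul1r mulrC mulfVK//.
exact: disc_sub1_neq0.
Unshelve. all: by end_near. Qed.
End cesaro.

(** * The polynomial factor of a preimage *)

Section preimage_poly.
Context {K : numFieldType}.

(** For a branch q of the square root of 1 + x, this is the polynomial left in the derivative of x q
    (1 + x)^-n P once q (1 + x)^-(n+1) is taken out. The order of the singularity at -1 thus grows
    by one. *)
Definition preimage_poly (n : nat) (P : {poly K}) : {poly K} :=
  (1 + 'X) * P + (2^-1 - n%:R)%:P * 'X * P + 'X * (1 + 'X) * P^`().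

Lemma preimage_is_derive (q : K -> K) (n : nat) (P : {poly K}) (z : K) :
  1 + z != 0 -> is_derive z 1 q (q z / (2 * (1 + z))) ->
  is_derive z 1 (fun x => x * (q x * (1 + x) ^- n * P.[x]))
    (q z * (1 + z) ^- n.+1 * (preimage_poly n P).[z]).
Proof.
move=> z0 dq.
have dn := is_derive_invXn n z0.
have dP := is_derive_horner P z.
have -> : (fun x => x * (q x * (1 + x) ^- n * P.[x])) =
  id * (q * (fun x => (1 + x) ^- n) * horner P) by [].
apply: is_derive_eq.
rewrite /preimage_poly !hornerE !mulrfctE /=.
have sE (a b : K) : a *: b = a * b by [].
rewrite !sE !exprS.
field.
by rewrite z0 expf_neq0.
Qed.

(** At -1 only the middle term survives, and with the factor 1 - (-1) = 2 the value is (2n - 1)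
    P(-1), where 2n - 1 is odd. The half-integer exponent supplied by the square root is what
    prevents a zero here. *)
Lemma preimage_poly_neq0 (n : nat) (P : {poly K}) :
  P.[-1] != 0 -> ((1 - 'X) * preimage_poly n P).[-1] != 0.
Proof.
move=> P0; rewrite /preimage_poly !hornerE.
have -> : (1 - -1) * ((1 + -1) * P.[-1] + (2^-1 - n%:R) * -1 * P.[-1]
   + -1 * (1 + -1) * P^`().[-1]) = (n.*2%:R - 1) * P.[-1].
  by rewrite -muln2 natrM; field.
apply: mulf_neq0 => //; rewrite subr_eq0 pnatr_eq1.
by apply/eqP => /(congr1 odd); rewrite odd_double.
Qed.

End preimage_poly.

(** * The square root of 1 + z on the disc *)

Section sqrt_disc.
Context {R : realType}.
Implicit Types (z : R[i]).

Lemma Re_sqrtc_gt0 z : 0 < complex.Re z -> 0 < complex.Re (sqrtc z).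
Proof.
case: z => a b /= a0; rewrite sqrtr_gt0 divr_gt0// ltr_pwDr// sqrtr_ge0.
Qed.

Lemma disc_Re z : disc z -> 0 < complex.Re (1 + z).
Proof.
move=> dz; have := normc_ge_Re z; rewrite lecR => /le_lt_trans/(_ dz).
by rewrite raddfD/= ltr_norml => /andP[+ _]; rewrite -ltrBlDl sub0r.
Qed.

Lemma normc_sqrtc z : normc (sqrtc z) ^+ 2 = normc z.
Proof. by rewrite expr2 -normcM -expr2 sqr_sqrtc. Qed.

Lemma sqrtc_is_derive z : disc z ->
  is_derive (z : R[i]^o) 1 ((fun x => sqrtc (1 + x)) : R[i]^o -> R[i]^o)
    (sqrtc (1 + z) / (2 * (1 + z))).
Proof.
(* On the disc 1 + x has positive real part, hence so does its principal root. Real parts therefore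
   add without cancellation, and |q x + q z| >= Re q z. *)
move=> dz; pose c := (complex.Re (sqrtc (1 + z)))%:C.
apply: (@sqrt_branch_is_derive R[i] (fun x => sqrtc (1 + x)) z c).
  by rewrite ltcR; exact/Re_sqrtc_gt0/disc_Re.
have : nbhs (z : R[i]^o) (disc (R := R)).
  by apply: open_nbhs_nbhs; split => //; exact: disc_open.
apply: filterS => x dx; split; first exact: sqr_sqrtc.
apply: le_trans (normc_ge_Re _); rewrite lecR raddfD/=.
by apply: le_trans (ler_norm _); rewrite lerDr ltW// Re_sqrtc_gt0// disc_Re.
Qed.

Definition sqrt_disc z : R[i]^o := if normc z < 1 then sqrtc (1 + z) else 0.

Lemma sqrt_disc_analytic : analytic_on_disc sqrt_disc.
Proof.
split=> [z dz|z dz]; last by rewrite /sqrt_disc; case: ifPn.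
have E : \forall x \near (z : R[i]^o), sqrtc (1 + x) = sqrt_disc x.
  have : nbhs (z : R[i]^o) (disc (R := R)).
    by apply: open_nbhs_nbhs; split => //; exact: disc_open.
  by apply: filterS => x dx; rewrite /sqrt_disc dx.
have [] := sqrtc_is_derive dz; move=> + _.
apply: near_eq_derivable => //.
Qed.

Lemma sqrt_disc_bounded z : normc (sqrt_disc z) <= 2.
Proof.
rewrite /sqrt_disc; case: ifPn => z1; last by rewrite normc0.
rewrite -(ler_pXn2r (n := 2)) ?nnegrE ?normc_ge0// normc_sqrtc.
by apply: le_trans (le_normcD _ _) _; rewrite normc1; lra.
Qed.
End sqrt_disc.

(** * Membership criteria for Bergman spaces *)

Section bergman.
Context {R : realType}.
Implicit Types (f : R[i] -> R[i]^o) (z : R[i]) (p mu nu : R).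
Let leb := @lebesgue_measure R.

Lemma box_measure (a b c d : R) : a <= b -> c <= d ->
  ((leb \x leb) (`[a, b] `*` `[c, d]) = ((b - a) * (d - c))%:E)%E.
Proof.
have L (x y : R) : x <= y -> leb `[x, y]%classic = (y - x)%:E.
  move=> xy; rewrite /leb lebesgue_measure_itv/= lte_fin -EFinB.
  case: ltP => // yx; congr EFin; apply/eqP.
  by rewrite eq_sym subr_eq0 eq_le xy yx.
move=> ab cd; rewrite EFinM -(L a b)// -(L c d)//.
by apply: product_measure1E; exact: measurable_itv.
Qed.

Lemma disc_measurable : measurable (@complex_of R @^-1` disc (R := R)).
Proof. by apply: open_prod_measurable; exact: open_disc2. Qed.

(** For mu >= 0 the weight is at most 1, so the integrand is bounded by M^p on the disc, which has
    finite area. *)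
Lemma bounded_bergman f p mu (M : R) : 0 < p -> 0 <= mu -> analytic_on_disc f ->
  (forall z, disc z -> normc (f z) <= M) -> bergman_set p mu f.
Proof.
move=> p0 mu0 af fM; split => //; apply/bergman_norm_lty => //.
apply: (@le_lt_trans _ _
    (\int[leb \x leb]_(w in @complex_of R @^-1` disc (R := R)) (M `^ p)%:E)%E).
  apply: ge0_le_integral.
  - exact: disc_measurable.
  - by move=> w _; rewrite lee_fin mulr_ge0// powR_ge0.
  - exact: integrand_measurable.
  - exact: measurable_cst.
  move=> w dw; rewrite lee_fin -[leRHS]mulr1.
  have z0 := normc_ge0 (complex_of w).
  have z1 : normc (complex_of w) < 1 := dw.
  apply: ler_pM; rewrite ?powR_ge0//.
    apply: ge0_ler_powR; rewrite ?nnegrE ?(ltW p0) ?normc_ge0 ?fM//.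
    by rewrite (le_trans (normc_ge0 _) (fM _ dw)).
  rewrite -[leRHS]/((fun=> 1) mu) -powR1.
  apply: ge0_ler_powR; rewrite ?nnegrE//; lra.
rewrite integral_cst; last exact: disc_measurable.
apply: lte_mul_pinfty; rewrite ?lee_fin ?powR_ge0//.
apply: (@le_lt_trans _ _ ((leb \x leb)%E (`[-1, 1] `*` `[-1, 1]))).
  apply: le_measure; rewrite ?inE; first exact: disc_measurable.
    by apply: measurableX; exact: measurable_itv.
  move=> w /= dw; have := normc_ge_Re (complex_of w).
  have := normc_ge_Re (complex_of w * 'i); rewrite ReiNIm normrN !lecR.
  rewrite normcM [normc 'i]/= expr0n expr1n add0r sqrtr1 mulr1.
  move=> /le_lt_trans/(_ dw) + /le_lt_trans/(_ dw).
  rewrite !in_itv/= !ltr_norml => /andP[/ltW -> /ltW ->].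
  by move=> /andP[/ltW -> /ltW ->].
by rewrite box_measure ?ltry; lra.
Qed.

(** The square touches neither -1 nor the circle: its distances to both are of order e. The first
    bound comes from (1 - e)^2 + e^2 <= (1 - e/2)^2, valid for e <= 1/3. *)
Lemma box_bound (e x y : R) : 0 < e <= 3^-1 ->
  -1 + e <= x <= -1 + 2 * e -> 0 <= y <= e ->
  normc (x +i* y) <= 1 - e / 2 /\ normc (1 + (x +i* y)) <= 3 * e.
Proof.
move=> /andP[e0 e1] /andP[x1 x2] /andP[y1 y2]; split.
  rewrite -(ler_pXn2r (n := 2)) ?nnegrE ?normc_ge0//; last lra.
  rewrite /normc sqr_sqrtr ?addr_ge0 ?sqr_ge0//.
  have xx : x ^+ 2 <= (1 - e) ^+ 2 by rewrite -sqrrN ler_pXn2r ?nnegrE//; lra.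
  have yy : y ^+ 2 <= e ^+ 2 by rewrite ler_pXn2r ?nnegrE//; lra.
  apply: le_trans (lerD xx yy) _.
  have : 0 <= e * (3^-1 - e) by rewrite mulr_ge0//; lra.
  rewrite !expr2; lra.
have -> : 1 + (x +i* y) = (1 + x) +i* y by simpc.
apply: le_trans (normc_complex _ _) _.
by rewrite !ger0_norm; lra.
Qed.

(* On the square -1 + [e, 2e] + i [0, e], of area e^2, the integrand is at least
   of order e^-3, and e is arbitrary. *)
Lemma pole_not_bergman f p nu (N : nat) (delta eta : R) :
  1 <= p -> nu <= N%:R -> 0 < delta -> 0 < eta ->
  (forall z, disc z -> normc (1 + z) < eta ->
    delta / normc (1 + z) ^+ N.+3 <= normc (f z)) ->
  ~ bergman_set p nu f.
Proof.
move=> p1 nuN d0 e0 fp [af /bergman_norm_lty].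
move=> /(_ (lt_le_trans ltr01 p1)).
set J := integral _ _ _; move=> Jfin.
have {Jfin} [r [r0 Jr]] : exists r, 0 <= r /\ J = r%:E.
  have J0 : (0 <= J)%E.
    by apply: integral_ge0 => w _; rewrite lee_fin mulr_ge0// powR_ge0.
  exists (fine J); split; first exact: fine_ge0.
  by rewrite fineK// ge0_fin_numE.
(* With K below, c is the constant for which K (e/2)^N times the area e^2 equals c / e. *)
pose c := delta / (3 ^+ N.+3 * 2 ^+ N).
have c0 : 0 < c by rewrite divr_gt0// mulr_gt0// exprn_gt0.
(* The bound 1/3 puts the square in the disc, delta / 3 helps to give K >= 1, eta / 6 keeps the
   square within eta of -1, and c / (r + 1) makes c / e exceed the integral r. *)
pose e := Num.min (Num.min 3^-1 (delta / 3)) (Num.min (eta / 6) (c / (r + 1))).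
have e_gt0 : 0 < e.
  by rewrite !lt_min !divr_gt0//; lra.
have [ea eb] : e <= 3^-1 /\ e <= delta / 3.
  by split; rewrite !ge_min lexx ?orbT.
have [ec ed] : e <= eta / 6 /\ e <= c / (r + 1).
  by split; rewrite !ge_min lexx ?orbT.
pose K := delta / (3 * e) ^+ N.+3.
(* Because K >= 1 and p >= 1, |f|^p >= K^p >= K on the square. *)
have K1 : 1 <= K.
  rewrite ler_pdivlMr ?exprn_gt0 ?mulr_gt0// mul1r.
  apply: (@le_trans _ _ (3 * e)); last lra.
  rewrite exprS ler_piMr ?exprn_ile1//; lra.
pose box := `[-1 + e, -1 + 2 * e] `*` `[0, e].
have mbox : measurable box by apply: measurableX; exact: measurable_itv.
have boxP w : box w -> normc (complex_of w) <= 1 - e / 2 /\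
    normc (1 + complex_of w) <= 3 * e.
  case: w => x y [/=]; rewrite !in_itv/= => hx hy.
  by apply: box_bound; rewrite ?e_gt0.
have boxD : box `<=` @complex_of R @^-1` disc (R := R).
  by move=> w /boxP[h _]; apply: le_lt_trans h _;
    rewrite ltrBlDr ltrDl divr_gt0.
suff : ((K * (e / 2) ^+ N)%:E * (leb \x leb) box <= J)%E.
  rewrite Jr box_measure; [|lra..].
  rewrite -EFinM lee_fin.
  have -> : K * (e / 2) ^+ N * ((-1 + 2 * e - (-1 + e)) * (e - 0)) = c / e.
    rewrite /K /c !exprMn !exprS exprVn; field.
    by rewrite !expf_neq0 ?gt_eqF.
  have : r + 1 <= c / e.
    move: ed; rewrite ler_pdivlMr; last lra.
    by rewrite mulrC -ler_pdivlMr.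
  lra.
rewrite -integral_cst//.
apply: (@le_trans _ _ (\int[leb \x leb]_(w in box)
    ((normc (f (complex_of w))) `^ p * (1 - normc (complex_of w)) `^ nu)%:E)%E).
  apply: ge0_le_integral => //.
  - move=> w _; rewrite lee_fin mulr_ge0 ?exprn_ge0//; lra.
  - exact: (measurable_funS disc_measurable boxD
      (integrand_measurable p nu af)).
  move=> w bw; have [w1 w2] := boxP _ bw; rewrite lee_fin.
  have dw := boxD _ bw.
  have w0 : 0 < normc (1 + complex_of w).
    rewrite lt_neqAle normc_ge0 andbT eq_sym; apply/eqP => /eq0_normc.
    by apply/eqP; exact: disc_add1_neq0.
  apply: ler_pM; rewrite ?exprn_ge0//; [lra|lra| |].
    have Kf : K <= normc (f (complex_of w)).
      apply: le_trans (fp _ dw _); last lra.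
      rewrite ler_pM2l// lef_pV2 ?posrE ?exprn_gt0 ?mulr_gt0//.
      by apply: lerXn2r; rewrite ?nnegrE ?normc_ge0// mulr_ge0// ltW.
    apply: (le_trans Kf).
    by rewrite -[leLHS]powRr1 ?normc_ge0// ler_powR// (le_trans K1).
  (* The base 1 - |w| lies in (0, 1], so raising the exponent from nu to N only decreases the
     power. *)
  rewrite -powR_mulrn; last lra.
  apply: (@le_trans _ _ ((1 - normc (complex_of w)) `^ N%:R)).
    by apply: ge0_ler_powR; rewrite ?nnegrE//; lra.
  apply: ger_powR => //; apply/andP; split; first lra.
  by rewrite lerBlDr lerDl normc_ge0.
apply: ge0_subset_integral => //.
- exact: disc_measurable.
- exact: integrand_measurable.
- by move=> w _; rewrite lee_fin mulr_ge0// powR_ge0.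
Qed.

End bergman.

(** * Failure of surjectivity *)

Section cesaro_surj.
Context {R : realType}.
Implicit Types (f g : R[i] -> R[i]^o) (X : set (R[i] -> R[i]^o)) (p nu : R).

(** Each step takes a preimage and applies [cesaro_op_inverse], which multiplies the derivative by 1
    - z. The origin is excluded there, which is harmless for a singularity at -1. The set X is kept
    abstract to cover both spaces. *)
Lemma cesaro_preimage_chain X : (forall f, X f -> analytic_on_disc f) ->
  X (sqrt_disc (R := R)) ->
  (forall g, X g -> exists2 f, X f & cesaro_op f = g) ->
  forall n, exists f (P : {poly R[i]}), [/\ X f, P.[-1] != 0
    & forall z, disc z -> z != 0 ->
        f z = sqrtc (1 + z) * (1 + z) ^- n * P.[z]].
Proof.
move=> Xa X0 Xs; elim=> [|n [g [P [Xg P0 gE]]]].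
  exists (sqrt_disc (R := R)), 1; split => //.
    by rewrite hornerE oner_neq0.
  by move=> z dz _; rewrite /sqrt_disc dz expr0 invr1 !mulr1 hornerE mulr1.
have [f Xf fg] := Xs _ Xg.
exists f, ((1 - 'X) * preimage_poly n P); split => //.
  exact: preimage_poly_neq0.
move=> z dz z0.
rewrite (cesaro_op_inverse (g := fun x => sqrtc (1 + x) * (1 + x) ^- n * P.[x])
  (Xa _ Xf) dz z0 _ (preimage_is_derive n P (disc_add1_neq0 dz)
    (sqrtc_is_derive dz))).
  by rewrite hornerM [RHS]mulrCA; congr (_ * _); rewrite !hornerE.
by move=> x dx x0; rewrite fg gE.
Qed.

Lemma horner_lower_bound (P : {poly R[i]}) : P.[-1] != 0 ->
  exists eta, 0 < eta /\ forall z, normc (1 + z) < eta ->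
    normc P.[-1] / 2 <= normc P.[z].
Proof.
move=> P0.
have P1 : 0 < normc P.[-1].
  rewrite lt_neqAle normc_ge0 andbT eq_sym.
  by apply: contra_neq P0 => /eq0_normc.
have cP : {for (-1 : R[i]^o), continuous (horner P : R[i]^o -> R[i]^o)}.
  apply/differentiable_continuous/derivable1_diffP.
  by have [] := is_derive_horner P (-1).
have cN : {for (-1 : R[i]^o),
    continuous ((normc (R := R) \o horner P) : R[i]^o -> R)}.
  exact: (@continuous_comp _ _ _ (horner P : R[i]^o -> R[i]^o) _ _ cP
    (@continuous_normc R _)).
have h : normc P.[-1] / 2 < normc P.[-1] by lra.
have := cN _ (lt_nbhsr h).
rewrite -nbhs_ballE => -[e /= e0 eU].
(* A positive element of [R[i]] is real. *)
have [er re0] : e = (complex.Re e)%:C /\ 0 < complex.Re e.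
  by move: e0; case: (e) => a b; rewrite ltcE/= => /andP[/eqP -> ->].
exists (complex.Re e); split => // z hz; apply/ltW; apply: eU.
rewrite /ball/= er ltcR -normcN opprB opprK addrC.
exact: hz.
Qed.

Lemma cesaro_op_not_surjective X p nu : 1 <= p -> X `<=` bergman_set p nu ->
  X (sqrt_disc (R := R)) ->
  ~ forall g, X g -> exists2 f, X f & cesaro_op f = g.
Proof.
move=> p1 Xnu X0 Xs.
pose N := (Num.truncn nu).+1.
have nuN : nu <= N%:R by apply/ltW; rewrite truncnS_gt.
have Xa f : X f -> analytic_on_disc f by move=> /Xnu[].
(* [pole_not_bergman] asks for order N + 3; the extra step pays for the factor sqrt(1 + z), which is
   at least |1 + z| in modulus near -1. *)
have [f [P [Xf P0 fE]]] := cesaro_preimage_chain Xa X0 Xs N.+4.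
have [eta [e0 Pd]] := horner_lower_bound P0.
(* The radius is kept at most 1 for two reasons: |1 + z| < 1 excludes z = 0, and it gives |sqrt(1 +
   z)| >= |1 + z|. *)
apply: (@pole_not_bergman _ f p nu N (normc P.[-1] / 2) (Num.min 1 eta)) => //.
- rewrite divr_gt0// lt_neqAle normc_ge0 andbT eq_sym.
  by apply: contra_neq P0 => /eq0_normc.
- by rewrite lt_min ltr01.
- move=> z dz; rewrite lt_min => /andP[w1 /Pd Pz].
  have z0 : z != 0.
    by apply: contraTneq w1 => ->; rewrite addr0 normc1 ltxx.
  have w0 : 0 < normc (1 + z).
    rewrite lt_neqAle normc_ge0 andbT eq_sym.
    by apply: contra_neq (disc_add1_neq0 dz) => /eq0_normc.
  have nX (k : nat) : normc ((1 + z) ^+ k) = normc (1 + z) ^+ k.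
    by elim: k => [|k ih]; rewrite ?expr0 ?normc1// !exprS normcM ih.
  rewrite fE// !normcM normcV nX mulrC.
  apply: ler_pM; rewrite ?invr_ge0 ?exprn_ge0 ?divr_ge0 ?normc_ge0//.
  have -> : (normc (1 + z) ^+ N.+3)^-1 = normc (1 + z) / normc (1 + z) ^+ N.+4.
    by rewrite [_ ^+ N.+4]exprS [in RHS]invfM mulVKf// gt_eqF.
  apply: ler_wpM2r; first by rewrite invr_ge0 exprn_ge0// normc_ge0.
  rewrite -normc_sqrtc expr2 ler_piMl// ?normc_ge0//.
  rewrite -(ler_pXn2r (n := 2)) ?nnegrE ?normc_ge0// normc_sqrtc expr1n.
  exact: ltW.
- exact: Xnu.
Qed.

(** The preimage of g is U g: T acts as C on underlying functions, so a right inverse of T is one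
    for C on S. *)
Lemma restricts_to_surjective (S : set (R[i] -> R[i]^o))
    (S_closed : GRing.submod_closed (fun v : R[i] -> R[i]^o => v \in S))
    (C : (R[i] -> R[i]^o) -> (R[i] -> R[i]^o))
    (T U : submodule S_closed -> submodule S_closed) :
  restricts_to C T -> cancel U T ->
  forall g, S g -> exists2 f, S f & C f = g.
Proof.
move=> TC UT g Sg.
exists (submodule_val (U (Submodule (S_closed := S_closed) (mem_set Sg)))).
  by apply: set_mem; exact: valP.
by rewrite -TC UT.
Qed.

End cesaro_surj.

Theorem proposition2p1 (R : realType) (p alpha : R) (p1 : 1 < p)
    (alpha0 : 0 < alpha) :
  (~ exists2 T : bergman_plus p1 alpha -> bergman_plus p1 alpha,
       restricts_to (@cesaro_op R) T & is_isomorphism T) /\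
  (~ exists2 T : bergman_minus p1 alpha0 -> bergman_minus p1 alpha0,
       restricts_to (@cesaro_op R) T & is_isomorphism T).
Proof.
have sqrtA mu : 0 < mu -> bergman_set p mu (sqrt_disc (R := R)).
  move=> /ltW mu0; apply: (@bounded_bergman _ _ _ _ 2) => //.
  - exact: lt_trans ltr01 p1.
  - exact: sqrt_disc_analytic.
  - by move=> z _; exact: sqrt_disc_bounded.
split=> -[T TC [_ _ [S [_ ST _]]]].
(* The intersection over weights above alpha lies in the space of weight alpha + 1. *)
- apply: (@cesaro_op_not_surjective _ (bergman_plus_set p alpha) p (alpha + 1)
    (ltW p1)).
  + by move=> f; apply; rewrite /= ltrDl.
  + by move=> mu /(lt_trans alpha0); exact: sqrtA.
  + exact: restricts_to_surjective TC ST.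
(* Bergman spaces grow with the weight, so the union over mu < alpha lies in the space of weight
   alpha itself. *)
- apply: (@cesaro_op_not_surjective _ (bergman_minus_set p alpha) p alpha
    (ltW p1)).
  + move=> f [mu /andP[_ mua]]; apply: bergman_set_le; last exact: ltW.
    exact: lt_trans ltr01 p1.
  + exists (alpha / 2); first by rewrite /= divr_gt0//=; lra.
    by apply: sqrtA; rewrite divr_gt0.
  + exact: restricts_to_surjective TC ST.
Qed.
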